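(* Let $M$ be a matroid on $E$ and $F$ a flat of $M$. The operators $\phi(K)$, $\phi(L\gtrdot K)$ and $\phi(K\lessdot L)$ on $\widetilde{\mathcal B}_F$ (for flats $K$, and flats $K\lessdot L$) satisfy the relations (FS) and ($\bigwedge$), and thus define an $S(M)$-module structure on $\widetilde{\mathcal B}_F$, in which a flag path $(K_1,\dots,K_m)$ acts by $\phi(K_1,K_2)\circ\phi(K_2,K_3)\circ\dots\circ\phi(K_{m-1},K_m)$.
   Context: $M$ is a matroid on a finite ground set $E$ with lattice of flats $\mathcal L$ ordered by inclusion and rank function $\rho$. For flats write $K\lessdot L$ (or $L\gtrdot K$) if $L$ covers $K$. A flag path is a finite nonempty sequence $(K_1,\dots,K_l)$ of flats with $K_i\lessdot K_{i+1}$ or $K_i\gtrdot K_{i+1}$ for each $i<l$. The free $\mathbb Z$-module on flag paths is an algebra under concatenation: $(K_1,\dots,K_l)\cdot(L_1,\dots,L_{l'})=(K_1,\dots,K_l=L_1,L_2,\dots,L_{l'})$ if $K_l=L_1$ and $0$ otherwise. $S(M)$ is its quotient by the two-sided ideal generated by: (FS) for flats $L<K$ with $\rho(K)=\rho(L)+2$: $\sum_X(L\lessdot X\lessdot K)=0=\sum_X(K\gtrdot X\gtrdot L)$, sums over flats $X$ with $K\gtrdot X\gtrdot L$; ($\bigwedge$) for $K\lessdot L$ and $K'\lessdot L$: $(K\lessdot L\gtrdot K')$ equals $|L\setminus K|\,(K)$ if $K=K'$; $-(K\gtrdot K\cap K'\lessdot K')$ if $K\ne K'$ and $K\cap K'\lessdot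 K$; and $0$ otherwise. The module. Fix a total order on $E$. In the exterior algebra over $\mathbb Z$ on the set of generators $E$, for $S=\{s_1<\dots<s_p\}\subseteq E$ put $e_S=s_1\wedge\dots\wedge s_p$; the monomials $e_S$ are orthonormal for a symmetric form $\langle\,,\rangle$. For flats $F\subseteq G$, $M^G_F$ is the restriction of $M$ to $G$ contracted by $F$ (a matroid on $G\setminus F$ whose bases are the subsets $B\subseteq G\setminus F$ with $|B|=\rho(G)-\rho(F)$ and $G$ the closure of $F\cup B$); let $\mathcal B^G_F$ be the free $\mathbb Z$-module spanned by the monomials $e_B$ for bases $B$ of $M^G_F$, and $\mathcal B^G_F=0$ if $F\not\subseteq G$. Put $\widetilde{\mathcal B}_F=\bigoplus_{G\in\mathcal L}\mathcal B^G_F$. The operators. $\phi(K)$ is the projection onto $\mathcal B^K_F$. For $K\lessdot L$ let $d^L_K=\sum_{i\in L\setminus K}i$; for $b\in\mathcal B^G_F$, $\phi(L\gtrdot K)(b)=d^L_K\wedge b\in\mathcal B^L_F$ if $G=K$ and $0$ otherwise. $\phi(K\lessdot L)$ is the adjoint of $\phi(L\gtrdot K)$ for $\langle\,,\rangle$; explicitly, for a basis $B$ of $M^G_F$, $\phi(K\lessdot L)(e_B)=\varepsilon(i,B)\,e_{B\cap K}\in\mathcal B^K_F$ if $G=L$, $K\supseteq F$ and $B\cap K$ is a basis of $M^K_F$ (with $i$ the unique element of $B\setminus K$ and $\varepsilon(i,B)=(-1)^{|\{j\in B:\,j<i\}|}$), and $0$ otherwise. Here $\phi(K_a,K_{a+1})$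 denotes $\phi(K_a\gtrdot K_{a+1})$ or $\phi(K_a\lessdot K_{a+1})$ as appropriate. *)

(* Defs.v *)
From HB Require Import structures.
From mathcomp Require Import all_boot all_order all_algebra.
From mathcomp Require Import finmap monalg boolp.

Set Implicit Arguments.
Unset Strict Implicit.
Unset Printing Implicit Defensive.

Import Order.TTheory GRing.Theory Num.Theory.
Local Open Scope ring_scope.

Record matroid (E : finType) := Matroid {
  indep : pred {set E};
  indep0 : indep set0;
  indepS : forall I J : {set E}, I \subset J -> indep J -> indep I;
  indep_aug : forall I J : {set E}, indep I -> indep J -> (#|I| < #|J|)%N ->
    exists2 x, x \in J :\: I & indep (x |: I) }.

Section Flats.
Variables (E : finType) (M : matroid E).
Implicit Types A B I J : {set E}.

Definition rank A : nat :=
  (\max_(I : {set E} | indep M I && (I \subset A)) #|I|)%N.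

Definition closure A : {set E} := [set x | rank (x |: A) == rank A].

Definition is_flat A : bool := closure A == A.

Lemma rank_ub A I : indep M I -> I \subset A -> (#|I| <= rank A)%N.
Proof. by move=> iI sIA; apply: (leq_bigmax_cond I); rewrite iI. Qed.

Lemma rank_ex A : exists I, [/\ indep M I, I \subset A & #|I| = rank A].
Proof.
pose P := [pred I : {set E} | indep M I && (I \subset A)].
have P0 : (0 < #|P|)%N by apply/card_gt0P; exists set0; rewrite inE indep0 sub0set.
have [I /andP[iI sIA] e] := eq_bigmax_cond (fun I : {set E} => #|I|) P0.
by exists I; split=> //; rewrite /rank -e.
Qed.

Lemma rankS A B : A \subset B -> (rank A <= rank B)%N.
Proof.
move=> sAB; have [I [iI sI <-]] := rank_ex A.
by apply: rank_ub => //; apply: subset_trans sAB.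
Qed.

Lemma rankU1_le A x : (rank (x |: A) <= (rank A).+1)%N.
Proof.
have [I [iI sI <-]] := rank_ex (x |: A).
rewrite (cardsD1 x) -add1n leq_add ?leq_b1 //.
by apply: rank_ub; [apply: indepS iI; apply: subsetDl | rewrite subDset].
Qed.

Lemma indep_ext A I : indep M I -> I \subset A ->
  exists J, [/\ indep M J, I \subset J, J \subset A & #|J| = rank A].
Proof.
move: {2}(rank A - #|I|)%N (leqnn (rank A - #|I|)) => n.
elim: n I => [|n IHn] I hn iI sIA.
  exists I; split=> //; apply/eqP; rewrite eqn_leq rank_ub //=.
  by rewrite -subn_eq0 -leqn0.
have [] := leqP (rank A) #|I| => [le|lt].
  by exists I; split=> //; apply/eqP; rewrite eqn_leq rank_ub.
have [J [iJ sJ eJ]] := rank_ex A; rewrite -eJ in lt.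
have [x] := indep_aug iI iJ lt; rewrite inE => /andP[xI xJ] ixI.
have xA : x \in A by apply: (subsetP sJ).
have [||K [iK sK sKA eK]] := IHn (x |: I) _ ixI.
- by rewrite cardsU1 xI add1n subnS; move: hn; case: (_ - _)%N.
- by rewrite subUset sub1set xA.
exists K; split=> //; apply: subset_trans sK; exact: subsetUr.
Qed.

Lemma closure_mono A B : A \subset B -> closure A \subset closure B.
Proof.
move=> sAB; apply/subsetP=> x; rewrite !inE => /eqP rx.
have [I [iI sI eI]] := rank_ex A.
have [J [iJ sIJ sJB eJ]] := indep_ext iI (subset_trans sI sAB).
rewrite eqn_leq (rankS (subsetUr _ _)) andbT leqNgt; apply/negP=> lt.
have [K [iK sK eK]] := rank_ex (x |: B).
rewrite -eJ -eK in lt; have [y] := indep_aug iJ iK lt.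
rewrite inE => /andP[yJ yK] iyJ.
have yx : y = x.
  move: (subsetP sK _ yK); rewrite !inE => /orP[/eqP//|yB].
  have := rank_ub iyJ; rewrite cardsU1 yJ => /(_ B).
  by rewrite subUset sub1set yB sJB eJ ltnn => /(_ isT).
have : indep M (x |: I) by apply: indepS iyJ; rewrite yx; apply: setUS.
move/rank_ub => /(_ (x |: A)); rewrite setUS // => /(_ isT).
rewrite cardsU1 rx eI -yx.
have -> : y \notin I by apply: contra yJ; apply: (subsetP sIJ).
by rewrite add1n ltnn.
Qed.

Lemma closure_sub A : A \subset closure A.
Proof. by apply/subsetP=> x xA; rewrite inE setUC (setUidPl _) // sub1set. Qed.

Lemma is_flatI A B : is_flat A -> is_flat B -> is_flat (A :&: B).
Proof.
move=> /eqP fA /eqP fB; rewrite /is_flat eqEsubset closure_sub andbT subsetI.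
by rewrite -{2}fA -{3}fB !closure_mono ?subsetIl ?subsetIr.
Qed.

Lemma rankU_closure A B : B \subset closure A -> rank (A :|: B) = rank A.
Proof.
move=> sB; apply/eqP; rewrite eqn_leq (rankS (subsetUl _ _)) andbT.
have [I [iI sI eI]] := rank_ex A.
have [J [iJ sIJ sJ <-]] := indep_ext iI (subset_trans sI (subsetUl A B)).
rewrite -eI; suff -> : J = I by [].
apply/eqP; rewrite eqEsubset sIJ andbT; apply/subsetP=> x xJ.
apply/negPn/negP=> xI.
have : x \in closure A.
  by move: (subsetP sJ _ xJ); rewrite !inE => /orP[xA|/(subsetP sB)];
    [rewrite (setUidPr _) // sub1set | rewrite inE].
have : indep M (x |: I) by apply: indepS iJ; rewrite subUset sub1set xJ.
move/rank_ub => /(_ (x |: A)); rewrite setUS // => /(_ isT).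
by rewrite cardsU1 xI eI add1n inE => h /eqP e; rewrite e ltnn in h.
Qed.

Lemma rank_closure A : rank (closure A) = rank A.
Proof.
by rewrite -[RHS](rankU_closure (subxx (closure A))) (setUidPr (closure_sub A)).
Qed.

Lemma closure_flat A : is_flat (closure A).
Proof.
rewrite /is_flat eqEsubset closure_sub andbT; apply/subsetP=> x.
rewrite inE rank_closure inE => /eqP e.
rewrite eqn_leq (rankS (subsetUr _ _)) andbT -{1}e.
by apply: rankS; apply/setUS/closure_sub.
Qed.

Record flat := Flat { flat_set :> {set E}; flatP : is_flat flat_set }.

HB.instance Definition _ := [isSub for flat_set].
HB.instance Definition _ := [Finite of flat by <:].

Definition flat_meet (K L : flat) : flat := Flat (is_flatI (flatP K) (flatP L)).

(* covers K L is K ⋖ L *)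
Definition covers (K L : flat) : bool :=
  (K \proper L) && [forall X : flat, ~~ ((K \proper X) && (X \proper L))].

Lemma closure_subflat A (L : flat) : A \subset L -> closure A \subset L.
Proof. by move/closure_mono; rewrite (eqP (flatP L)). Qed.

Lemma covers_closure (K L : flat) A :
  covers K L -> K \subset A -> A \subset L -> A != K -> closure A = L.
Proof.
case/andP=> pKL /forallP nX sKA sAL nAK.
have sKcA := subset_trans sKA (closure_sub A).
have scAL := closure_subflat sAL.
have : ~~ ((K \proper closure A) && (closure A \proper L)) :=
  nX (Flat (closure_flat A)).
rewrite negb_and !properE sKcA scAL /= !negbK.
case/orP=> [s|s]; last by apply/eqP; rewrite eqEsubset s scAL.
by case/negP: nAK; rewrite eqEsubset sKA (subset_trans (closure_sub A)).
Qed.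

Lemma covers_rank (K L : flat) : covers K L -> rank L = (rank K).+1.
Proof.
move=> cKL; have /andP[/properP[sKL [x xL xK]] _] := cKL.
rewrite -(covers_closure cKL (subsetUr [set x] K)); first last.
- by apply: contraNneq xK => <-; rewrite setU11.
- by rewrite subUset sub1set xL.
rewrite rank_closure; apply/eqP; rewrite eqn_leq rankU1_le ltn_neqAle.
rewrite (rankS (subsetUr _ _)) andbT eq_sym; apply: contra xK => e.
by rewrite -(eqP (flatP K)) inE.
Qed.

End Flats.

Notation "K ⋖ L" := (covers K L) (at level 70, no associativity).

(* a flag path is stored as its first flat together with the list of the
   remaining ones *)
Record flag_path (E : finType) (M : matroid E) := FlagPath {
  fp_val :> flat M * seq (flat M);
  fp_valP : path (fun K L => (K ⋖ L) || (L ⋖ K)) fp_val.1 fp_val.2 }.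

HB.instance Definition _ (E : finType) (M : matroid E) := [isSub for @fp_val E M].
HB.instance Definition _ (E : finType) (M : matroid E) := [Choice of flag_path M by <:].

Section FreeZmod.
Variables (K : choiceType) (V : zmodType).
Implicit Types (f : K -> V) (x y : {malg int[K]}).

Definition mlin f x : V := \sum_(k <- msupp x) f k *~ x@_k.

Lemma mlinEw f x (d : {fset K}) : (msupp x `<=` d)%fset ->
  mlin f x = \sum_(k <- d) f k *~ x@_k.
Proof.
move=> le; rewrite /mlin (big_fset_incl _ le) // => k _.
by move/mcoeff_outdom->; rewrite mulr0z.
Qed.

Lemma mlinD f : {morph mlin f : x y / x + y}.
Proof.
move=> x y; have sx := fsubsetUl (msupp x) (msupp y).
have sy := fsubsetUr (msupp x) (msupp y).
rewrite (mlinEw f (msuppD_le x y)) (mlinEw f sx) (mlinEw f sy).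
by rewrite -big_split; apply: eq_bigr => k _; rewrite mcoeffD mulrzDr.
Qed.

Lemma mlinU f k : mlin f << k >> = f k.
Proof.
by rewrite (mlinEw f (d := [fset k]%fset)) ?msuppU_le // big_seq_fset1 mcoeffUU.
Qed.

Lemma mlin0 f : mlin f 0 = 0.
Proof. by rewrite /mlin msupp0 big_seq_fset0. Qed.

Lemma mlinN f x : mlin f (- x) = - mlin f x.
Proof. by apply: (addrI (mlin f x)); rewrite -mlinD !subrr mlin0. Qed.

Lemma mlin_fun0 x : mlin (fun=> 0) x = 0.
Proof. by rewrite /mlin big1 // => k _; rewrite mul0rz. Qed.

Lemma mlin_funD f g x : mlin (fun k => f k + g k) x = mlin f x + mlin g x.
Proof. by rewrite /mlin -big_split; apply: eq_bigr => k _; rewrite mulrzDl. Qed.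

Lemma eq_mlin f g x : f =1 g -> mlin f x = mlin g x.
Proof. by move=> e; apply: eq_bigr => k _; rewrite e. Qed.

End FreeZmod.

Lemma malg_ind (K : choiceType) (P : {malg int[K]} -> Prop) :
  P 0 -> (forall x y, P x -> P y -> P (x + y)) -> (forall x, P x -> P (- x)) ->
  (forall k, P << k >>) -> forall x, P x.
Proof.
move=> P0 PD PN PU x; rewrite [x]monalgE.
elim/big_ind: _ => // k _; have PUn n : P << n%:Z *g k >>.
  elim: n => [|n IHn]; first by rewrite monalgU0.
  by rewrite -addn1 PoszD monalgUD; apply: PD.
by case: (x@_k) => n //; rewrite NegzE monalgUN; apply: PN.
Qed.

Section PathAlgebra.
Variables (E : finType) (M : matroid E).
Implicit Types (p q r : flag_path M).

Definition path_alg := {malg int[flag_path M]}.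
HB.instance Definition _ := GRing.Zmodule.on path_alg.

Implicit Types (x y z : path_alg).

(* [flag K s] is the generator (K, s_1, ..., s_m) when that sequence is a flag
   path, and 0 otherwise *)
Definition flag (K : flat M) (s : seq (flat M)) : path_alg :=
  if insub (K, s) is Some p then << (p : flag_path M) >> else 0.

Definition concat p q : path_alg :=
  if last p.1 p.2 == q.1 then flag p.1 (p.2 ++ q.2) else 0.

Definition path_mul x y : path_alg :=
  mlin (fun p => mlin (fun q => concat p q) y) x.

Definition path_one : path_alg := \sum_(K : flat M) flag K [::].

Lemma flagE p : flag p.1 p.2 = << p >>.
Proof. by rewrite /flag -surjective_pairing valK. Qed.

Lemma flag_concat p q (e : last p.1 p.2 == q.1) :
  path (fun K L => (K ⋖ L) || (L ⋖ K)) p.1 (p.2 ++ q.2).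
Proof. by rewrite cat_path fp_valP (eqP e) fp_valP. Qed.

Lemma path_mulDl : left_distributive path_mul +%R.
Proof. by move=> x y z; rewrite /path_mul mlinD. Qed.

Lemma path_mulDr : right_distributive path_mul +%R.
Proof.
move=> x y z; rewrite /path_mul -mlin_funD; apply: eq_mlin => p.
by rewrite mlinD.
Qed.

Lemma path_mul0l x : path_mul 0 x = 0.
Proof. by rewrite /path_mul mlin0. Qed.

Lemma path_mul0r x : path_mul x 0 = 0.
Proof.
by rewrite /path_mul -[RHS](mlin_fun0 path_alg x); apply: eq_mlin => p; apply: mlin0.
Qed.

Lemma path_mulNl x y : path_mul (- x) y = - path_mul x y.
Proof. by rewrite /path_mul mlinN. Qed.

Lemma path_mulNr x y : path_mul x (- y) = - path_mul x y.
Proof. by apply: (addrI (path_mul x y)); rewrite -path_mulDr !subrr path_mul0r. Qed.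

Lemma path_mulUU p q : path_mul << p >> << q >> = concat p q.
Proof. by rewrite /path_mul !mlinU. Qed.

(* an opaque copy of p |-> << p >>, which keeps unification from unfolding the
   finitely supported functions *)
Lemma flag_genP : { g : flag_path M -> path_alg | [/\ forall p, g p = << p >>,
  forall p, flag p.1 p.2 = g p & forall p q, path_mul (g p) (g q) = concat p q] }.
Proof.
by exists (fun p => << p >>); split=> [//|p|p q]; [apply: flagE | apply: path_mulUU].
Qed.

Definition flag_gen : flag_path M -> path_alg := sval flag_genP.

Lemma flag_genE p : flag_gen p = << p >>.
Proof. by case: (svalP flag_genP). Qed.

Lemma flagEgen p : flag p.1 p.2 = flag_gen p.
Proof. by case: (svalP flag_genP). Qed.

Lemma path_mul_gen p q : path_mul (flag_gen p) (flag_gen q) = concat p q.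
Proof. by case: (svalP flag_genP). Qed.

Lemma path_alg_ind (P : path_alg -> Prop) :
  P 0 -> (forall x y, P x -> P y -> P (x + y)) -> (forall x, P x -> P (- x)) ->
  (forall p, P (flag_gen p)) -> forall x, P x.
Proof.
by move=> P0 PD PN PU; apply: malg_ind => // p; rewrite -flag_genE; apply: PU.
Qed.

Lemma concat_some p q : last p.1 p.2 == q.1 ->
  { r : flag_path M | (r.1 = p.1) * (r.2 = p.2 ++ q.2) & concat p q = flag_gen r }.
Proof.
move=> e; exists (@FlagPath _ M (p.1, p.2 ++ q.2) (flag_concat e)) => //.
by rewrite /concat e -flagEgen.
Qed.

Lemma path_mulA : associative path_mul.
Proof.
elim/path_alg_ind => [|x x' Hx Hx'|x Hx|p] y z.
- by rewrite !path_mul0l.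
- by rewrite !path_mulDl Hx Hx'.
- by rewrite !path_mulNl Hx.
elim/path_alg_ind: y => [|y y' Hy Hy'|y Hy|q].
- by rewrite !(path_mul0l, path_mul0r).
- by rewrite !(path_mulDl, path_mulDr) Hy Hy'.
- by rewrite !(path_mulNl, path_mulNr) Hy.
elim/path_alg_ind: z => [|z z' Hz Hz'|z Hz|r].
- by rewrite !path_mul0r.
- by rewrite !path_mulDr Hz Hz'.
- by rewrite !path_mulNr Hz.
rewrite !path_mul_gen.
have [e1|n1] := boolP (last p.1 p.2 == q.1); last first.
  rewrite [concat p q]/concat (negPf n1) path_mul0l.
  have [e2|n2] := boolP (last q.1 q.2 == r.1); last first.
    by rewrite /concat (negPf n2) path_mul0r.
  have [s [s1 _] ->] := concat_some e2.
  by rewrite path_mul_gen /concat s1 (negPf n1).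
have [s [s1 s2] ->] := concat_some e1; rewrite path_mul_gen.
have ls : last s.1 s.2 = last q.1 q.2 by rewrite s1 s2 last_cat (eqP e1).
have [e2|n2] := boolP (last q.1 q.2 == r.1); last first.
  by rewrite /concat ls (negPf n2) path_mul0r.
have [t [t1 t2] ->] := concat_some e2; rewrite path_mul_gen.
by rewrite /concat ls t1 e1 e2 s1 s2 t2 catA.
Qed.

Lemma path_sum_l (I : finType) (F : I -> path_alg) y :
  path_mul (\sum_i F i) y = \sum_i path_mul (F i) y.
Proof.
apply: (big_morph (fun x => path_mul x y)) => [u v|]; first exact: path_mulDl.
exact: path_mul0l.
Qed.

Lemma path_sum_r (I : finType) (F : I -> path_alg) x :
  path_mul x (\sum_i F i) = \sum_i path_mul x (F i).
Proof.
apply: (big_morph (path_mul x)) => [u v|]; first exact: path_mulDr.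
exact: path_mul0r.
Qed.

Definition flag1 (K : flat M) : flag_path M := @FlagPath _ M (K, [::]) isT.

Lemma path_mul1 : left_id path_one path_mul.
Proof.
elim/path_alg_ind => [|x y Hx Hy|x Hx|p].
- by rewrite path_mul0r.
- by rewrite path_mulDr Hx Hy.
- by rewrite path_mulNr Hx.
rewrite /path_one path_sum_l (bigD1 p.1) //= big1 => [|K nK].
  by rewrite (flagEgen (flag1 p.1)) path_mul_gen /concat /= eqxx flagEgen addr0.
by rewrite (flagEgen (flag1 K)) path_mul_gen /concat /= (negPf nK).
Qed.

Lemma path_mulr1 : right_id path_one path_mul.
Proof.
elim/path_alg_ind => [|x y Hx Hy|x Hx|p].
- by rewrite path_mul0l.
- by rewrite path_mulDl Hx Hy.
- by rewrite path_mulNl Hx.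
rewrite /path_one path_sum_r (bigD1 (last p.1 p.2)) //= big1 => [|K nK].
  by rewrite (flagEgen (flag1 _)) path_mul_gen /concat /= eqxx cats0 flagEgen addr0.
by rewrite (flagEgen (flag1 K)) path_mul_gen /concat /= eq_sym (negPf nK).
Qed.

HB.instance Definition _ := GRing.Zmodule_isPzRing.Build path_alg
  path_mulA path_mul1 path_mulr1 path_mulDl path_mulDr.

End PathAlgebra.

Section TwoSidedQuotient.
Variables (R : pzRingType) (gen : R -> Prop).

Inductive ideal_gen : R -> Prop :=
| ideal_gen_in x : gen x -> ideal_gen x
| ideal_gen0 : ideal_gen 0
| ideal_genB x y : ideal_gen x -> ideal_gen y -> ideal_gen (x - y)
| ideal_genMl a x : ideal_gen x -> ideal_gen (a * x)
| ideal_genMr a x : ideal_gen x -> ideal_gen (x * a).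

Definition ideal : R -> bool := fun x => `[< ideal_gen x >].

Lemma ideal_zmod_closed : zmod_closed ideal.
Proof.
split=> [|x y]; first exact/asboolP/ideal_gen0.
by move=> /asboolP Ix /asboolP Iy; apply/asboolP/ideal_genB.
Qed.

HB.instance Definition _ := GRing.isZmodClosed.Build R ideal ideal_zmod_closed.

Definition quot_ring := Quotient.quot (GRing.ZmodClosed.clone R ideal _).
HB.instance Definition _ := GRing.Zmodule.on quot_ring.
HB.instance Definition _ := EqQuotient.on quot_ring.

Definition quot_class (x : R) : quot_ring := (\pi_quot_ring x)%qT.

Lemma quot_classP x y : quot_class x = quot_class y <-> ideal_gen (x - y).
Proof.
split=> [/eqP|h]; first by rewrite /quot_class -Quotient.idealrBE => /asboolP.
by apply/eqP; rewrite /quot_class -Quotient.idealrBE; apply/asboolP.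
Qed.

Lemma quot_classD : {morph quot_class : x y / x + y}.
Proof. by move=> x y; rewrite /quot_class [RHS]piE. Qed.

Definition quot_mul (u v : quot_ring) : quot_ring :=
  quot_class (repr u * repr v).

Lemma quot_classK u : quot_class (repr u) = u.
Proof. exact: reprK. Qed.

Lemma quot_classM x y : quot_class (x * y) = quot_mul (quot_class x) (quot_class y).
Proof.
apply/quot_classP.
set x' := repr _; set y' := repr _.
have Ix : ideal_gen (x - x') by apply/quot_classP; rewrite quot_classK.
have Iy : ideal_gen (y - y') by apply/quot_classP; rewrite quot_classK.
have -> : x * y - x' * y' = (x - x') * y - (x' * (- (y - y'))).
  by rewrite mulrBl mulrN opprK mulrBr addrA subrK.
apply: ideal_genB; first exact: ideal_genMr.
by apply: ideal_genMl; rewrite -[- _]sub0r; apply: ideal_genB => //; apply: ideal_gen0.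
Qed.

Lemma quot_mulA : associative quot_mul.
Proof.
move=> u v w; rewrite -[u]quot_classK -[v]quot_classK -[w]quot_classK.
by rewrite -!quot_classM mulrA.
Qed.

Lemma quot_mul1 : left_id (quot_class 1) quot_mul.
Proof. by move=> u; rewrite -[u]quot_classK -quot_classM mul1r. Qed.

Lemma quot_mulr1 : right_id (quot_class 1) quot_mul.
Proof. by move=> u; rewrite -[u]quot_classK -quot_classM mulr1. Qed.

Lemma quot_mulDl : left_distributive quot_mul +%R.
Proof.
move=> u v w; rewrite -[u]quot_classK -[v]quot_classK -[w]quot_classK.
by rewrite -quot_classD -!quot_classM -quot_classD mulrDl.
Qed.

Lemma quot_mulDr : right_distributive quot_mul +%R.
Proof.
move=> u v w; rewrite -[u]quot_classK -[v]quot_classK -[w]quot_classK.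
by rewrite -quot_classD -!quot_classM -quot_classD mulrDr.
Qed.

HB.instance Definition _ := GRing.Zmodule_isPzRing.Build quot_ring
  quot_mulA quot_mul1 quot_mulr1 quot_mulDl quot_mulDr.

End TwoSidedQuotient.

Section FlagAlgebra.
Variables (E : finType) (M : matroid E).
Implicit Types K L X : flat M.

Inductive S_relation : path_alg M -> Prop :=
| rel_FS_up L K : L \proper K -> rank M K = (rank M L + 2)%N ->
    S_relation (\sum_(X | (L ⋖ X) && (X ⋖ K)) flag L [:: X; K])
| rel_FS_down L K : L \proper K -> rank M K = (rank M L + 2)%N ->
    S_relation (\sum_(X | (L ⋖ X) && (X ⋖ K)) flag K [:: X; L])
| rel_wedge K K' L : K ⋖ L -> K' ⋖ L ->
    S_relation (flag K [:: L; K'] -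
      (if K == K' then flag K [::] *+ #|L :\: K|
       else if flat_meet K K' ⋖ K then - flag K [:: flat_meet K K'; K']
       else 0)).

Definition flag_alg := quot_ring S_relation.
HB.instance Definition _ := GRing.PzRing.on flag_alg.

Definition flag_class (p : flag_path M) : flag_alg :=
  quot_class S_relation << p >>.

End FlagAlgebra.

(* the axioms of GRing.Zmodule_isLmodule *)
Record left_module_law (R : pzRingType) (V : zmodType) (act : R -> V -> V) : Prop :=
  LeftModuleLaw {
    act_mul : forall a b v, act a (act b v) = act (a * b) v;
    act_one : left_id 1 act;
    act_addr : right_distributive act +%R;
    act_addl : forall v, {morph act^~ v : a b / a + b} }.

Section Exterior.
Variables (d : Order.disp_t) (E : finOrderType d).
Implicit Types (A B C : {set E}).

(* an element of the exterior algebra is given by its coordinates in the basis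
   of monomials e_A *)
Definition ext := {ffun {set E} -> int}.
HB.instance Definition _ := GRing.Zmodule.on ext.

Implicit Types (u v w : ext).

Definition ext_mon A : ext := [ffun B => (B == A)%:R].

(* the sign of the permutation sorting (a_1 < ... < a_p, b_1 < ... < b_q) *)
Definition ext_sign A B : int :=
  (-1) ^+ (\sum_(a in A) #|[set b in B | (b < a)%O]|)%N.

Definition ext_mon_mul A B : ext :=
  if [disjoint A & B] then ext_mon (A :|: B) *~ ext_sign A B else 0.

Definition wedge u v : ext := \sum_A \sum_B ext_mon_mul A B *~ (u A * v B).

Lemma extE u : u = \sum_A ext_mon A *~ u A.
Proof.
apply/ffunP=> B; rewrite sum_ffunE (bigD1 B) //= big1 => [|A nA].
  by rewrite addr0 ffunMzE ffunE eqxx intz.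
by rewrite ffunMzE ffunE eq_sym (negPf nA) mul0rz.
Qed.

Lemma ext_ind (P : ext -> Prop) :
  P 0 -> (forall u v, P u -> P v -> P (u + v)) -> (forall u, P u -> P (- u)) ->
  (forall A, P (ext_mon A)) -> forall u, P u.
Proof.
move=> P0 PD PN PU u; rewrite [u]extE; elim/big_ind: _ => // A _.
have Pn n : P (ext_mon A *+ n).
  by elim: n => [|n IHn]; rewrite ?mulr0n // mulrS; apply: PD.
by case: (u A) => n; [rewrite -pmulrn | rewrite NegzE mulrNz -pmulrn; apply: PN].
Qed.

Lemma wedgeDl : left_distributive wedge +%R.
Proof.
move=> u v w; rewrite /wedge -big_split; apply: eq_bigr => A _.
rewrite -big_split; apply: eq_bigr => B _.
by rewrite ffunE mulrDl mulrzDr.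
Qed.

Lemma wedgeDr : right_distributive wedge +%R.
Proof.
move=> u v w; rewrite /wedge -big_split; apply: eq_bigr => A _.
rewrite -big_split; apply: eq_bigr => B _.
by rewrite ffunE mulrDr mulrzDr.
Qed.

Lemma wedge0l u : wedge 0 u = 0.
Proof. by apply: (addrI (wedge 0 u)); rewrite -wedgeDl !addr0. Qed.

Lemma wedge0r u : wedge u 0 = 0.
Proof. by apply: (addrI (wedge u 0)); rewrite -wedgeDr !addr0. Qed.

Lemma wedgeNl u v : wedge (- u) v = - wedge u v.
Proof. by apply: (addrI (wedge u v)); rewrite -wedgeDl !subrr wedge0l. Qed.

Lemma wedgeNr u v : wedge u (- v) = - wedge u v.
Proof. by apply: (addrI (wedge u v)); rewrite -wedgeDr !subrr wedge0r. Qed.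

Lemma wedge_mon A B : wedge (ext_mon A) (ext_mon B) = ext_mon_mul A B.
Proof.
rewrite /wedge (bigD1 A) //= [X in _ + X]big1 => [|A' nA']; last first.
  by rewrite big1 // => B' _; rewrite ffunE (negPf nA') mul0r.
rewrite (bigD1 B) //= [X in _ + X + _]big1 => [|B' nB'].
  by rewrite !addr0 !ffunE !eqxx mulr1.
by rewrite !ffunE (negPf nB') mulr0.
Qed.

Lemma wedgeZl u v (n : int) : wedge (u *~ n) v = wedge u v *~ n.
Proof.
have wn m : wedge (u *+ m) v = wedge u v *+ m.
  by elim: m => [|m IHm]; rewrite ?mulr0n ?wedge0l // !mulrS wedgeDl IHm.
by case: n => m; rewrite ?NegzE ?mulrNz -?pmulrn ?wedgeNl wn.
Qed.

Lemma wedgeZr u v (n : int) : wedge u (v *~ n) = wedge u v *~ n.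
Proof.
have wn m : wedge u (v *+ m) = wedge u v *+ m.
  by elim: m => [|m IHm]; rewrite ?mulr0n ?wedge0r // !mulrS wedgeDr IHm.
by case: n => m; rewrite ?NegzE ?mulrNz -?pmulrn ?wedgeNr wn.
Qed.

Lemma ext_signUl A B C :
  [disjoint A & B] -> ext_sign (A :|: B) C = ext_sign A C * ext_sign B C.
Proof.
move=> dAB; rewrite /ext_sign -exprD; congr (_ ^+ _).
by rewrite -bigU //=; apply: eq_bigl => x; rewrite !inE.
Qed.


Lemma ext_signUr A B C :
  [disjoint B & C] -> ext_sign A (B :|: C) = ext_sign A B * ext_sign A C.
Proof.
move=> dBC; rewrite /ext_sign -exprD -big_split; congr (_ ^+ _).
apply: eq_bigr => a _ /=; rewrite -cardsUI [X in (_ = _ + X)%N]eq_card0 => [|x].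
  by rewrite addn0; apply: eq_card => x; rewrite !inE andb_orl.
rewrite !inE; apply/negP=> /andP[/andP[xB _] /andP[xC _]].
by move/pred0P: dBC => /(_ x); rewrite /= xB xC.
Qed.

Lemma disjointsUl A B C :
  [disjoint A :|: B & C] = [disjoint A & C] && [disjoint B & C].
Proof. by rewrite !disjoints_subset subUset. Qed.

Lemma disjointsUr A B C :
  [disjoint A & B :|: C] = [disjoint A & B] && [disjoint A & C].
Proof. by rewrite ![[disjoint A & _]]disjoint_sym disjointsUl. Qed.

Lemma wedgeA : associative wedge.
Proof.
elim/ext_ind => [|u u' Hu Hu'|u Hu|A] v w.
- by rewrite !wedge0l.
- by rewrite !wedgeDl Hu Hu'.
- by rewrite !wedgeNl Hu.
elim/ext_ind: v => [|v v' Hv Hv'|v Hv|B].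
- by rewrite !(wedge0l, wedge0r).
- by rewrite !(wedgeDl, wedgeDr) Hv Hv'.
- by rewrite !(wedgeNl, wedgeNr) Hv.
elim/ext_ind: w => [|w w' Hw Hw'|w Hw|C].
- by rewrite !wedge0r.
- by rewrite !wedgeDr Hw Hw'.
- by rewrite !wedgeNr Hw.
rewrite !wedge_mon /ext_mon_mul.
have [dBC|nBC] := boolP [disjoint B & C]; last first.
  rewrite wedge0r; case: ifP => _; last by rewrite wedge0l.
  rewrite wedgeZl wedge_mon /ext_mon_mul.
  by rewrite disjointsUl (negPf nBC) andbF mul0rz.
rewrite wedgeZr wedge_mon /ext_mon_mul disjointsUr.
have [dAB|nAB] := boolP [disjoint A & B]; last by rewrite mul0rz wedge0l.
rewrite wedgeZl wedge_mon /ext_mon_mul disjointsUl dBC andbT.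
have [dAC|nAC] := boolP [disjoint A & C]; last by rewrite !mul0rz.
rewrite setUA ext_signUl // ext_signUr // -!mulrzA; congr (_ *~ _).
by rewrite -mulrA mulrC.
Qed.

Lemma wedge1 : left_id (ext_mon set0) wedge.
Proof.
elim/ext_ind => [|v v' Hv Hv'|v Hv|B].
- by rewrite wedge0r.
- by rewrite wedgeDr Hv Hv'.
- by rewrite wedgeNr Hv.
by rewrite wedge_mon /ext_mon_mul -setI_eq0 set0I eqxx set0U /ext_sign big_set0 mulr1z.
Qed.

Lemma wedger1 : right_id (ext_mon set0) wedge.
Proof.
elim/ext_ind => [|v v' Hv Hv'|v Hv|B].
- by rewrite wedge0l.
- by rewrite wedgeDl Hv Hv'.
- by rewrite wedgeNl Hv.
rewrite wedge_mon /ext_mon_mul -setI_eq0 setI0 eqxx setU0 /ext_sign big1 ?mulr1z //.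
by move=> a _; apply: eq_card0 => x; rewrite !inE.
Qed.

HB.instance Definition _ := GRing.Zmodule_isPzRing.Build ext
  wedgeA wedge1 wedger1 wedgeDl wedgeDr.

Definition ext_gen (i : E) : ext := ext_mon [set i].

Lemma ext_gen_mul i A : ext_gen i * ext_mon A =
  if i \in A then 0 else ext_mon (i |: A) *~ (-1) ^+ #|[set j in A | (j < i)%O]|.
Proof.
rewrite [LHS]wedge_mon /ext_mon_mul disjoints1 /ext_sign big_set1.
by case: (i \in A).
Qed.

Lemma ext_gen_sqr i : ext_gen i * ext_gen i = 0.
Proof. by rewrite ext_gen_mul set11. Qed.

Lemma ext_genC i j : ext_gen i * ext_gen j = - (ext_gen j * ext_gen i).
Proof.
have cardE (x y : E) : #|[set z in [set x] | (z < y)%O]| = (x < y)%O.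
  have [lt|nlt] := boolP (x < y)%O.
    by apply/eqP/cards1P; exists x; apply/setP=> z; rewrite !inE; case: eqP => // ->.
  by apply: eq_card0 => z; rewrite !inE; apply/negP=> /andP[/eqP->]; apply/negP.
have [->|nij] := eqVneq i j; first by rewrite ext_gen_sqr oppr0.
rewrite !ext_gen_mul !inE [j == i]eq_sym (negPf nij) setUC !cardE.
by case: ltgtP nij => //= _ _; rewrite expr0 expr1 mulrNz ?opprK.
Qed.

Lemma ext_monE A : ext_mon A = \prod_(i <- sort <=%O (enum A)) ext_gen i.
Proof.
have prodE s : sorted <%O s -> \prod_(i <- s) ext_gen i = ext_mon [set x in s].
  elim: s => [|i s IHs] /= ss.
    by rewrite big_nil; congr ext_mon; apply/setP=> x; rewrite !inE.
  have lts : all (> i)%O s by apply: order_path_min ss; apply: lt_trans.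
  rewrite big_cons IHs ?(path_sorted ss) // ext_gen_mul inE.
  case: ifP => [/(allP lts)|_]; first by rewrite ltxx.
  rewrite eq_card0 ?mulr1z => [|x].
    by congr ext_mon; apply/setP=> x; rewrite !inE.
  rewrite !inE; apply/negP=> /andP[/(allP lts) lt gt].
  by have := lt_trans lt gt; rewrite ltxx.
rewrite prodE; last by rewrite sort_lt_sorted enum_uniq.
by congr ext_mon; apply/setP=> x; rewrite inE mem_sort mem_enum.
Qed.

(* the symmetric form for which the monomials are orthonormal *)
Definition ext_form u v : int := \sum_A u A * v A.

End Exterior.

Section Operators.
Variables (d : Order.disp_t) (E : finOrderType d) (M : matroid E) (F : flat M).
Implicit Types (G K L : flat M) (A B : {set E}) (u v : ext E).

(* B is a basis of the minor M^G_F; no such B exists unless F ⊆ G *)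
Definition minor_basis G B : bool :=
  [&& F \subset G, B \subset G :\: F, (#|B| + rank M F == rank M G)%N
    & closure M (F :|: B) == G].

(* the free submodule B^G_F spanned by the e_B, B a basis of M^G_F *)
Definition minor_span G u : bool := [forall B, (u B != 0) ==> minor_basis G B].

Lemma minor_spanP G u :
  reflect (forall B, ~~ minor_basis G B -> u B = 0) (minor_span G u).
Proof.
apply: (iffP forallP) => h B; last first.
  by apply/implyP=> uB; apply: contraR uB => /h ->.
by move/implyP: (h B) => hB /(contra hB); rewrite negbK => /eqP.
Qed.

Lemma minor_spanB G u v : minor_span G u -> minor_span G v -> minor_span G (u - v).
Proof.
move=> /minor_spanP hu /minor_spanP hv; apply/minor_spanP=> B nB.
by rewrite !ffunE hu ?hv // subrr.
Qed.

Lemma minor_span0 G : minor_span G 0.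
Proof. by apply/minor_spanP=> B _; rewrite ffunE. Qed.

Lemma minor_span_mon G B : minor_span G (ext_mon B) = minor_basis G B.
Proof.
apply/idP/idP=> [/minor_spanP h|bB].
  by apply: contraT => /h; rewrite ffunE eqxx.
apply/minor_spanP=> B' nB'; rewrite ffunE.
by case: eqP => // eB; rewrite eB bB in nB'.
Qed.

Definition Btilde_pred (b : {ffun flat M -> ext E}) : bool :=
  [forall G, minor_span G (b G)].

Lemma Btilde_zmod_closed : zmod_closed Btilde_pred.
Proof.
split=> [|b c /forallP hb /forallP hc]; apply/forallP=> G; rewrite !ffunE.
  exact: minor_span0.
exact: minor_spanB.
Qed.

HB.instance Definition _ :=
  GRing.isZmodClosed.Build {ffun flat M -> ext E} Btilde_pred Btilde_zmod_closed.

Record Btilde := MkBtilde {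
  Btilde_val :> {ffun flat M -> ext E}; BtildeP : Btilde_pred Btilde_val }.

HB.instance Definition _ := [isSub for Btilde_val].
HB.instance Definition _ := [Choice of Btilde by <:].
HB.instance Definition _ := [SubChoice_isSubZmodule of Btilde by <:].

Implicit Types (b c : Btilde).

Definition dsum K L : ext E := \sum_(i in L :\: K) ext_gen i.

Lemma minor_basisU K L i B : K ⋖ L -> i \in L :\: K -> minor_basis K B ->
  (i \notin B) && minor_basis L (i |: B).
Proof.
move=> cKL; rewrite inE => /andP[iK iL] /and4P[sFK sB /eqP cB /eqP clB].
have sKL : K \subset L by have /andP[/proper_sub] := cKL.
have sBK : B \subset K by apply: subset_trans sB (subsetDl _ _).
have iB : i \notin B by apply: contra iK; apply: (subsetP sBK).
rewrite iB /=; apply/and4P; split.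
- exact: subset_trans sFK sKL.
- rewrite subUset sub1set inE iL andbT (contra (subsetP sFK i)) //=.
  by apply: subset_trans sB _; apply: setSD.
- by rewrite cardsU1 iB (covers_rank cKL) -cB.
rewrite setUCA -(covers_closure cKL (subsetUr [set i] K)).
- rewrite eqEsubset; apply/andP; split.
    by apply: closure_mono; apply: setUS; rewrite -clB closure_sub.
  rewrite -(eqP (closure_flat M (i |: (F :|: B)))); apply: closure_mono.
  rewrite subUset sub1set (subsetP (closure_sub _ _)) ?setU11 //=.
  by rewrite -clB closure_mono // subsetUr.
- by rewrite subUset sub1set iL.
by apply: contraNneq iK => <-; rewrite setU11.
Qed.

Lemma minor_span_dsum K L u :
  K ⋖ L -> minor_span K u -> minor_span L (dsum K L * u).
Proof.
move=> cKL /minor_spanP hu.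
have spanD v w : minor_span L v -> minor_span L w -> minor_span L (v + w).
  move=> hv hw; rewrite -[w]opprK; apply: minor_spanB => //.
  by rewrite -[- w]sub0r; apply: minor_spanB => //; apply: minor_span0.
rewrite [u]extE mulr_sumr; apply: (big_ind (minor_span L)) => // [|B _].
  exact: minor_span0.
have [bB|/hu ->] := boolP (minor_basis K B); last by rewrite mulr0 minor_span0.
rewrite mulr_suml; apply: (big_ind (minor_span L)) => // [|i iLK].
  exact: minor_span0.
have /andP[iB biB] := minor_basisU cKL iLK bB.
rewrite [_ * _]wedgeZr [wedge _ _]ext_gen_mul (negPf iB) -mulrzA.
apply/minor_spanP=> B' nB'; rewrite ffunMzE ffunE.
by case: eqP => [eB|_]; [rewrite eB biB in nB' | rewrite mul0rz].
Qed.

Definition proj_val K b : {ffun flat M -> ext E} :=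
  [ffun G => if G == K then b K else 0].

Lemma proj_valP K b : Btilde_pred (proj_val K b).
Proof.
apply/forallP=> G; rewrite ffunE; case: eqP => [->|_]; last exact: minor_span0.
by have /forallP := BtildeP b.
Qed.

(* φ(K) *)
Definition phi_proj K b : Btilde := MkBtilde (proj_valP K b).

Definition raise_val K L b : {ffun flat M -> ext E} :=
  [ffun G => if (K ⋖ L) && (G == L) then dsum K L * b K else 0].

Lemma raise_valP K L b : Btilde_pred (raise_val K L b).
Proof.
apply/forallP=> G; rewrite ffunE; case: ifP => [/andP[cKL /eqP->]|_].
  by apply: minor_span_dsum => //; have /forallP := BtildeP b.
exact: minor_span0.
Qed.

(* φ(L ⋗ K) *)
Definition phi_raise K L b : Btilde := MkBtilde (raise_valP K L b).

Definition Bform b c : int := \sum_G ext_form (b G) (c G).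

(* e_B in the summand B^G_F, or 0 if B is not a basis of M^G_F *)
Definition Bmon G B : Btilde :=
  insubd 0 [ffun G' => if G' == G then ext_mon B else 0].

Definition adjoint (f : Btilde -> Btilde) b : Btilde :=
  \sum_G \sum_(B | minor_basis G B) Bmon G B *~ Bform b (f (Bmon G B)).

(* φ(K ⋖ L) *)
Definition phi_lower K L : Btilde -> Btilde := adjoint (phi_raise K L).

(* φ(K, L) *)
Definition phi_step K L : Btilde -> Btilde :=
  if K ⋖ L then phi_lower K L else phi_raise L K.

(* φ(K_1, K_2) ∘ ... ∘ φ(K_{m-1}, K_m) for the sequence K_1 :: s, and φ(K_1)
   when s is empty *)
Fixpoint phi_path K (s : seq (flat M)) : Btilde -> Btilde :=
  match s with
  | [::] => phi_proj K
  | [:: L] => phi_step K L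
  | L :: s' => phi_step K L \o phi_path L s'
  end.

Lemma BmonE G B : minor_basis G B ->
  Bmon G B = [ffun G' => if G' == G then ext_mon B else 0] :> {ffun _ -> _}.
Proof.
move=> bB; rewrite /Bmon insubdK //; apply/forallP=> G'; rewrite ffunE.
by case: eqP => [->|_]; [rewrite minor_span_mon | apply: minor_span0].
Qed.

Lemma Btilde_sumE (I : Type) (r : seq I) (P : pred I) (f : I -> Btilde) G :
  (\sum_(i <- r | P i) f i) G = \sum_(i <- r | P i) f i G.
Proof.
by apply: (big_morph (fun b => b G)) => [b c|]; rewrite /= ?ffunE.
Qed.

Lemma Btilde_mulzE b n G : (b *~ n) G = b G *~ n.
Proof.
have bm m : (b *+ m) G = b G *+ m.
  elim: m => [|m IHm]; first by rewrite !mulr0n /= ffunE.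
  by rewrite !mulrS /= ffunE IHm.
case: n => m; rewrite ?NegzE ?mulrNz -!pmulrn ?bm //.
by rewrite -bm /= ffunE.
Qed.

Lemma Btilde_coef0 b G B : ~~ minor_basis G B -> b G B = 0.
Proof. by have /forallP/(_ G)/minor_spanP := BtildeP b; apply. Qed.

Lemma BtildeE b : b = \sum_G \sum_(B | minor_basis G B) Bmon G B *~ b G B.
Proof.
apply/val_inj/ffunP=> G /=; rewrite Btilde_sumE (bigD1 G) //=.
rewrite [X in _ + X]big1 => [|G' nG]; last first.
  rewrite Btilde_sumE big1 // => B bB.
  by rewrite Btilde_mulzE BmonE // ffunE eq_sym (negPf nG) mul0rz.
rewrite addr0 Btilde_sumE [LHS]extE [LHS](bigID (minor_basis G)) /=.
rewrite [X in _ + X]big1 ?addr0 => [|B nB]; last by rewrite Btilde_coef0 ?mulr0z.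
by apply: eq_bigr => B bB; rewrite Btilde_mulzE BmonE // ffunE eqxx.
Qed.

Lemma BformDl b b' c : Bform (b + b') c = Bform b c + Bform b' c.
Proof.
rewrite /Bform -big_split; apply: eq_bigr => G _; rewrite /ext_form -big_split.
by apply: eq_bigr => B _; rewrite /= !ffunE mulrDl.
Qed.

Lemma BformC b c : Bform b c = Bform c b.
Proof.
by apply: eq_bigr => G _; apply: eq_bigr => B _; rewrite mulrC.
Qed.

Lemma BformDr b c c' : Bform b (c + c') = Bform b c + Bform b c'.
Proof. by rewrite ![Bform b _]BformC BformDl. Qed.

Lemma Bform0l c : Bform 0 c = 0.
Proof. by apply: (addrI (Bform 0 c)); rewrite -BformDl !addr0. Qed.

Lemma BformZl b c n : Bform (b *~ n) c = Bform b c * n.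
Proof.
rewrite /Bform mulr_suml; apply: eq_bigr => G _; rewrite mulr_suml.
apply: eq_bigr => B _; rewrite Btilde_mulzE ffunMzE.
by rewrite -mulrzr intz mulrAC.
Qed.

Lemma Bform_suml (I : Type) (r : seq I) (P : pred I) (f : I -> Btilde) c :
  Bform (\sum_(i <- r | P i) f i) c = \sum_(i <- r | P i) Bform (f i) c.
Proof.
apply: (big_morph (fun b => Bform b c)) => [b b'|]; first exact: BformDl.
exact: Bform0l.
Qed.

Lemma Bform_sumr (I : Type) (r : seq I) (P : pred I) (f : I -> Btilde) b :
  Bform b (\sum_(i <- r | P i) f i) = \sum_(i <- r | P i) Bform b (f i).
Proof. by rewrite BformC Bform_suml; apply: eq_bigr => i _; rewrite BformC. Qed.

Lemma Bform_mon G B b : minor_basis G B -> Bform (Bmon G B) b = b G B.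
Proof.
move=> bB; rewrite /Bform (bigD1 G) //= [X in _ + X]big1 => [|G' nG]; last first.
  by apply: big1 => B' _; rewrite BmonE // ffunE (negPf nG) ffunE mul0r.
rewrite addr0 /ext_form (bigD1 B) //= big1 => [|B' nB].
  by rewrite BmonE // !ffunE !eqxx ffunE eqxx mul1r addr0.
by rewrite BmonE // ffunE eqxx ffunE (negPf nB) mul0r.
Qed.

Lemma adjoint_coef f b G B :
  minor_basis G B -> adjoint f b G B = Bform b (f (Bmon G B)).
Proof.
move=> bB; rewrite -(Bform_mon _ bB) BformC /adjoint Bform_suml (bigD1 G) //=.
rewrite [X in _ + X]big1 => [|G' nG]; last first.
  rewrite Bform_suml big1 // => B' bB'.
  by rewrite BformZl Bform_mon // BmonE // ffunE (negPf nG) ffunE mul0r.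
rewrite addr0 Bform_suml (bigD1 B) //= big1 => [|B' /andP[bB' nB]].
  by rewrite BformZl Bform_mon // BmonE // ffunE eqxx ffunE eqxx mul1r addr0.
by rewrite BformZl Bform_mon // BmonE // ffunE eqxx ffunE (negPf nB) mul0r.
Qed.

Lemma additive_mulz (f : Btilde -> Btilde) :
  {morph f : b c / b + c} -> forall b n, f (b *~ n) = f b *~ n.
Proof.
move=> fD; have f0 : f 0 = 0 by apply: (addrI (f 0)); rewrite -fD !addr0.
have fN b : f (- b) = - f b by apply: (addrI (f b)); rewrite -fD !subrr.
have fn b m : f (b *+ m) = f b *+ m.
  by elim: m => [|m IHm]; rewrite ?mulr0n // !mulrS fD IHm.
by move=> b [] m; rewrite ?NegzE ?mulrNz -!pmulrn ?fN fn.
Qed.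

Lemma adjointP (f : Btilde -> Btilde) : {morph f : b c / b + c} ->
  forall b c, Bform (adjoint f b) c = Bform b (f c).
Proof.
move=> fD b c; have f0 : f 0 = 0 by apply: (addrI (f 0)); rewrite -fD !addr0.
rewrite [in RHS](BtildeE c) (big_morph f fD f0) Bform_sumr [c in LHS]BtildeE.
rewrite Bform_sumr; apply: eq_bigr => G _.
rewrite (big_morph f fD f0) !Bform_sumr; apply: eq_bigr => B bB.
rewrite (additive_mulz fD) ![Bform _ (_ *~ _)]BformC !BformZl; congr (_ * _).
by rewrite Bform_mon // adjoint_coef // BformC.
Qed.

Lemma phi_raiseD K L : {morph phi_raise K L : b c / b + c}.
Proof.
move=> b c; apply/val_inj/ffunP=> G; rewrite /= !ffunE.
by case: ifP => _; rewrite ?addr0 // mulrDr.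
Qed.

Lemma phi_lower_adjoint K L b c :
  Bform (phi_lower K L b) c = Bform b (phi_raise K L c).
Proof. exact: adjointP (@phi_raiseD K L) b c. Qed.

Lemma phi_raise_mon K L A : K ⋖ L -> minor_basis K A ->
  phi_raise K L (Bmon K A) = \sum_(i in L :\: K)
    Bmon L (i |: A) *~ (-1) ^+ #|[set j in A | (j < i)%O]|.
Proof.
move=> cKL bA; apply/val_inj/ffunP=> G; rewrite /= ffunE cKL Btilde_sumE /=.
rewrite BmonE // ffunE eqxx; case: eqP => [->|nG].
  rewrite mulr_suml; apply: eq_bigr => i iLK.
  have /andP[iA biA] := minor_basisU cKL iLK bA.
  by rewrite Btilde_mulzE BmonE // ffunE eqxx ext_gen_mul (negPf iA).
rewrite big1 // => i iLK; have /andP[_ biA] := minor_basisU cKL iLK bA.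
by rewrite Btilde_mulzE BmonE // ffunE (introF eqP nG) mul0rz.
Qed.

Lemma minor_basis_setI K L A i :
  minor_basis K A -> i \in L :\: K -> (i |: A) :&: K = A.
Proof.
move=> /and4P[_ sA _ _]; rewrite inE => /andP[iK _].
have sAK := subset_trans sA (subsetDl K F).
rewrite setIUl (setIidPl sAK) (_ : [set i] :&: K = set0) ?set0U //.
by apply/eqP; rewrite setI_eq0 disjoints1.
Qed.

Lemma phi_lower_coef K L G B G' A : K ⋖ L -> minor_basis G B ->
  minor_basis G' A -> phi_lower K L (Bmon G B) G' A =
    if [&& G == L, G' == K & A == B :&: K] then
      \sum_(i in L :\: K | B == i |: A) (-1) ^+ #|[set j in A | (j < i)%O]|
    else 0.
Proof.
move=> cKL bB bA; rewrite adjoint_coef // Bform_mon //.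
have [eG|nG] := eqVneq G L; last by rewrite /= ffunE (negPf nG) andbF ffunE.
have [eG'|nG'] := eqVneq G' K; last first.
  rewrite /= ffunE cKL eG eqxx (BmonE bA) ffunE eq_sym (negPf nG').
  by rewrite [_ * _]wedge0r ffunE.
rewrite eG' in bA *; rewrite phi_raise_mon // Btilde_sumE sum_ffunE eG.
rewrite !andTb.
rewrite [RHS](_ : _ = \sum_(i in L :\: K | B == i |: A)
    (-1) ^+ #|[set j in A | (j < i)%O]|); last first.
  case: eqP => // nA; rewrite big1 // => i /andP[iLK /eqP eB].
  by case: nA; rewrite eB (minor_basis_setI bA iLK).
rewrite [RHS]big_mkcondr; apply: eq_bigr => i iLK.
have /andP[_ biA] := minor_basisU cKL iLK bA.
rewrite Btilde_mulzE BmonE // ffunE eqxx ffunMzE ffunE.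
by case: eqP; rewrite ?mul0rz // intz.
Qed.

Lemma phi_lower_mon K L B i : K ⋖ L -> minor_basis L B ->
  B :\: K = [set i] -> minor_basis K (B :&: K) ->
  phi_lower K L (Bmon L B) =
    Bmon K (B :&: K) *~ (-1) ^+ #|[set j in B | (j < i)%O]|.
Proof.
move=> cKL bB eB bBK; apply/val_inj/ffunP=> G; apply/ffunP=> A /=.
have [bA|nA] := boolP (minor_basis G A); last by rewrite !Btilde_coef0.
rewrite phi_lower_coef // eqxx Btilde_mulzE BmonE // ffunE ffunMzE /=.
case: eqP => /= _; last by rewrite ffunE mul0rz.
rewrite ffunE; case: eqP => [->|_] /=; last by rewrite mul0rz.
have /[!inE]/andP[iK iB] : i \in B :\: K by rewrite eB set11.
have sBL : B \subset L by case/and4P: bB => _ /subset_trans-> //; apply: subsetDl.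
have eBi : i |: (B :&: K) = B by rewrite -eB setUC setID.
rewrite (big_pred1 i) ?intz => [|j]; last first.
  rewrite /= !inE; apply/andP/eqP => [[/andP[jK _] /eqP ej]|->].
    apply/set1P; rewrite -eB inE jK ej setU11 //.
  by rewrite iK (subsetP sBL) // eBi.
congr (_ ^+ _); apply: eq_card => j; rewrite !inE.
have [jK|jK] := boolP (j \in K); rewrite ?andbT // andbF /=.
apply/esym/negP=> /andP[jB]; have : j \in B :\: K by rewrite inE jK.
by rewrite eB inE => /eqP->; rewrite ltxx.
Qed.

Lemma phi_lower_mon0 K L G B : K ⋖ L -> minor_basis G B ->
  ~~ ((G == L) && minor_basis K (B :&: K)) -> phi_lower K L (Bmon G B) = 0.
Proof.
move=> cKL bB nB; apply/val_inj/ffunP=> G'; apply/ffunP=> A; rewrite /= !ffunE.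
have [bA|nA] := boolP (minor_basis G' A); last by rewrite Btilde_coef0.
rewrite phi_lower_coef //; case: ifP => // /and3P[eG /eqP eG' /eqP eA].
by rewrite eG -eA -eG' bA in nB.
Qed.

End Operators.

(* Main.v *)
Require Import Defs.
From HB Require Import structures.
From mathcomp Require Import all_boot all_order all_algebra.

Import Order.TTheory GRing.Theory Num.Theory.
Local Open Scope ring_scope.

(* For L < X < K one has d^K_X d^X_L = d^K_L d^X_L, since d^X_L squares to 0;
   the sets X \ L partition K \ L, so summing over X gives (d^K_L)^2 = 0, which is
   the descending half of (FS).  The ascending half is its adjoint.
   The wedge relation compares <d^L_K' b, d^L_K c> with the form on the
   contractions of b and c, and follows from the
   anticommutation of wedging by a generator and contracting by another:
   the Kronecker terms contribute only if K = K', and the contracted terms only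
   involve monomials e_C with C + i a basis over K and C + j a basis over K',
   which forces K /\ K' to be covered by K and C to be a basis over it. *)

(** * Ranks and cover relations of flats *)

Section FlatRank.
Set Implicit Arguments.
Unset Strict Implicit.
Variables (E : finType) (M : matroid E).
Implicit Types (K L X : flat M) (A B C : {set E}).

Lemma flat_rank_lt X K : X \proper K -> (rank M X < rank M K)%N.
Proof.
case/properP=> sXK [x xK xX].
apply: leq_trans (_ : rank M (x |: X) <= _)%N; last first.
  by apply: rankS; rewrite subUset sub1set xK.
rewrite ltn_neqAle (rankS _ (subsetUr _ _)) andbT eq_sym.
by apply: contra xX => e; rewrite -(eqP (flatP X)) inE.
Qed.

(** The closure of [A] is a flat inside [X]; were it proper, its rank, which is that of [A], would
    be smaller than that of [X]. *)
Lemma closure_eq_rank X A :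
  A \subset X -> (rank M X <= rank M A)%N -> Defs.closure M A = X.
Proof.
move=> sAX; rewrite -(rank_closure M A) => le.
apply/eqP; rewrite eqEproper closure_subflat //=.
apply: contraL le => lt; rewrite -ltnNge.
exact: (@flat_rank_lt (Flat (closure_flat M A))).
Qed.

Lemma covers_of_rank X K : X \proper K -> rank M K = (rank M X).+1 -> X ⋖ K.
Proof.
move=> pXK eK; rewrite /covers pXK; apply/forallP=> Y; apply/negP.
case/andP=> /flat_rank_lt lt1 /flat_rank_lt; rewrite eK ltnS.
by rewrite leqNgt lt1.
Qed.

Lemma covers_proper K L : K ⋖ L -> K \proper L.
Proof. by case/andP. Qed.

Lemma covers_asym K L : K ⋖ L -> ~~ (L ⋖ K).
Proof.
move/covers_proper/flat_rank_lt=> lt; apply/negP=> /covers_proper/flat_rank_lt.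
by rewrite ltnNge ltnW.
Qed.

Lemma flat_meetC K K' : flat_meet K K' = flat_meet K' K.
Proof. by apply: val_inj; rewrite /= setIC. Qed.

Lemma cocovers_meet_proper K K' L : K ⋖ L -> K' ⋖ L -> K != K' ->
  flat_meet K K' \proper K.
Proof.
move=> cK cK' nK; rewrite properE subsetIl /=; apply: contra nK => sK.
have {}sK : K \subset K' by apply: subset_trans sK (subsetIr _ _).
move: sK; rewrite subEproper => /orP[/eqP/val_inj->//|/flat_rank_lt].
by rewrite -ltnS -(covers_rank cK) -(covers_rank cK') ltnn.
Qed.

(** Both [K] and [K'] have rank one less than [L], so the meet has corank one in either or in
    neither. The wedge relation tests only [K]. *)
Lemma cocovers_meetr K K' L : K ⋖ L -> K' ⋖ L -> K != K' ->
  flat_meet K K' ⋖ K -> flat_meet K K' ⋖ K'.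
Proof.
move=> cK cK' nK cX; apply: covers_of_rank.
  by rewrite flat_meetC; apply: (cocovers_meet_proper cK' cK); rewrite eq_sym.
rewrite -(covers_rank cX); apply/eqP.
by rewrite -eqSS -(covers_rank cK) -(covers_rank cK').
Qed.

(** The witness is the closure of [i |: L], whose rank lies strictly between those of [L] and [K];
    [covers_closure] makes it the only candidate. *)
Lemma cover_between_unique L K i : L \subset K ->
  rank M K = (rank M L + 2)%N -> i \in K :\: L ->
  exists X0, forall X, [&& L ⋖ X, X ⋖ K & i \in X] = (X == X0).
Proof.
rewrite addn2 inE => sLK rK /andP[iL iK].
pose X0 := Flat (closure_flat M (i |: L)).
have sX0 : i |: L \subset X0 by apply: closure_sub.
have pLX0 : L \proper X0.
  apply/properP; split; first exact: subset_trans (subsetUr _ _) sX0.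
  by exists i => //; apply: (subsetP sX0); apply: setU11.
have rX0 : rank M X0 = (rank M L).+1.
  apply/eqP; rewrite eqn_leq (flat_rank_lt pLX0) andbT.
  by rewrite /= rank_closure rankU1_le.
have sX0K : X0 \subset K.
  by apply: closure_subflat; rewrite subUset sub1set iK.
exists X0 => X; apply/and3P/eqP => [[cX cK iX]|->].
  apply: val_inj => /=; rewrite (covers_closure cX) // ?subsetUr //.
    by rewrite subUset sub1set iX proper_sub // covers_proper.
  by apply: contraNneq iL => <-; apply: setU11.
split; last by apply: (subsetP sX0); apply: setU11.
- exact: covers_of_rank.
- apply: covers_of_rank; last by rewrite rK rX0.
  rewrite properEneq sX0K andbT; apply: contra_eqN rK => /eqP<-.
  by rewrite rX0 eqSS neq_ltn ltnSn.
Qed.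

End FlatRank.

Lemma sum_neq0_ex (I : finType) (V : nmodType) (P : pred I) (f : I -> V) :
  \sum_(i | P i) f i != 0 -> exists2 i, P i & f i != 0.
Proof.
move=> nz; apply/exists_inP; apply: contraNT nz => /exists_inPn f0.
by apply/eqP/big1 => i /f0; rewrite negbK => /eqP.
Qed.

(** * Wedging and contracting by single generators *)

Section InteriorProduct.
Set Implicit Arguments.
Unset Strict Implicit.
Variables (d : Order.disp_t) (E : finOrderType d).
Implicit Types (A B C D : {set E}) (u v w : ext E) (i j : E).

Definition pos_sign i A : int := (-1) ^+ #|[set k in A | (k < i)%O]|.

Lemma pos_signU1 i j A : i \notin A ->
  pos_sign j (i |: A) = (-1) ^+ (i < j)%O * pos_sign j A.
Proof.
move=> iA; rewrite /pos_sign -exprD; congr (_ ^+ _).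
rewrite (cardsD1 i) !inE eqxx /=; congr (_ + _)%N; apply: eq_card => k.
by rewrite !inE; case: eqP => [->|//]; rewrite (negPf iA).
Qed.

Lemma pos_sign_sqr i A : pos_sign i A * pos_sign i A = 1.
Proof. by rewrite -expr2 sqrr_sign. Qed.

Lemma ext_gen_mulE i u D :
  (ext_gen i * u) D = if i \in D then pos_sign i (D :\ i) * u (D :\ i) else 0.
Proof.
rewrite [u in LHS]extE mulr_sumr sum_ffunE.
under eq_bigr => A _ do rewrite [_ * _]wedgeZr [wedge _ _]ext_gen_mul ffunMzE.
have [iD|iD] := boolP (i \in D).
  rewrite (bigD1 (D :\ i)) //= big1 => [|A nA].
    rewrite setD11 setD1K // ffunMzE ffunE eqxx intz -mulrzr intz addr0.
    by rewrite mulrC.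
  case: ifP => iA; first by rewrite ffunE mul0rz.
  rewrite ffunMzE ffunE; case: eqP => [eD|_]; last by rewrite !mul0rz.
  by rewrite eD setU1K ?iA ?eqxx in nA.
rewrite big1 // => A _; case: ifP => iA; first by rewrite ffunE mul0rz.
rewrite ffunMzE ffunE; case: eqP => [eD|_]; last by rewrite !mul0rz.
by rewrite eD setU11 in iD.
Qed.

(** Contraction by [i], the adjoint of left multiplication by [ext_gen i]. The sign may be taken on
    [C] instead of [i |: C], since [i] is not below itself. *)
Definition interior i u : ext E :=
  [ffun C : {set E} => if i \in C then 0 else pos_sign i C * u (i |: C)].

Lemma ext_formC u v : ext_form u v = ext_form v u.
Proof. by apply: eq_bigr => A _; rewrite mulrC. Qed.

Lemma ext_formDl u u' v : ext_form (u + u') v = ext_form u v + ext_form u' v.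
Proof.
by rewrite /ext_form -big_split; apply: eq_bigr => A _; rewrite ffunE mulrDl.
Qed.

Lemma ext_form0l v : ext_form 0 v = 0.
Proof. by apply: big1 => A _; rewrite ffunE mul0r. Qed.

Lemma ext_form0r u : ext_form u 0 = 0.
Proof. by rewrite ext_formC ext_form0l. Qed.

Lemma ext_form_suml (I : Type) (r : seq I) (P : pred I) (f : I -> ext E) v :
  ext_form (\sum_(i <- r | P i) f i) v = \sum_(i <- r | P i) ext_form (f i) v.
Proof.
by apply: (big_morph (fun u => ext_form u v)) => [u u'|];
  [apply: ext_formDl | apply: ext_form0l].
Qed.

Lemma ext_form_sumr (I : Type) (r : seq I) (P : pred I) (f : I -> ext E) u :
  ext_form u (\sum_(i <- r | P i) f i) = \sum_(i <- r | P i) ext_form u (f i).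
Proof.
by rewrite ext_formC ext_form_suml; apply: eq_bigr => i _; rewrite ext_formC.
Qed.

Lemma interior_mon i u C : interior i u C = ext_form u (ext_gen i * ext_mon C).
Proof.
rewrite ffunE ext_gen_mul; case: ifP => iC; first by rewrite ext_form0r.
rewrite /ext_form (bigD1 (i |: C)) //= big1 => [|A nA].
  by rewrite ffunMzE ffunE eqxx intz addr0 mulrC.
by rewrite ffunMzE ffunE (negPf nA) mul0rz mulr0.
Qed.

Lemma reindex_setU1 (i : E) (P : pred {set E}) (f : {set E} -> int) :
  \sum_(D : {set E} | (i \in D) && P D) f D =
  \sum_(C : {set E} | (i \notin C) && P (i |: C)) f (i |: C).
Proof.
rewrite (reindex_onto (fun C => i |: C) (fun D => D :\ i)) /=; last first.
  by move=> D /andP[iD _]; rewrite setD1K.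
apply: eq_bigl => C; rewrite setU11 /= andbC; congr (_ && _).
apply/eqP/idP => [<-|iC]; [by rewrite setD11 | by rewrite setU1K].
Qed.

(** Swapping the two summation indices negates the product, and integer coordinates have no
    2-torsion. *)
Lemma sum_ext_gen_sqr (P : pred E) :
  (\sum_(i | P i) ext_gen i) * (\sum_(i | P i) ext_gen i) = 0.
Proof.
set x := _ * _; have xN : - x = x.
  have -> : x = \sum_(i | P i) \sum_(j | P j) ext_gen i * ext_gen j.
    by rewrite /x mulr_suml; apply: eq_bigr => i _; rewrite mulr_sumr.
  rewrite -sumrN [RHS]exchange_big; apply: eq_bigr => i _ /=.
  by rewrite -sumrN; apply: eq_bigr => j _; rewrite [RHS]ext_genC.
by apply/ffunP=> B; rewrite [RHS]ffunE; apply/eqP; rewrite -eqNr -{2}xN ffunE.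
Qed.

(* The anticommutation of wedging by [i] with contracting by [j], read through
   the form so that only contractions by single generators are needed. *)
Lemma ext_form_gen_gen i j u v :
  ext_form (ext_gen i * u) (ext_gen j * v) =
  (if i == j then ext_form u v else 0) - ext_form (interior j u) (interior i v).
Proof.
apply/eqP; rewrite -subr_eq opprK; apply/eqP.
(* With the contraction term moved to the left, one sum runs over the sets containing both [i] and
   [j], the other over the sets containing neither. *)
rewrite [X in X + _](_ : _ = \sum_(D : {set E} | (i \in D) && (j \in D))
    pos_sign i (D :\ i) * pos_sign j (D :\ j) * (u (D :\ i) * v (D :\ j))); last first.
  rewrite /ext_form [RHS]big_mkcond; apply: eq_bigr => D _.
  rewrite !ext_gen_mulE; case: (i \in D); case: (j \in D) => /=;
    by rewrite ?mul0r ?mulr0 // mulrACA.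
rewrite [X in _ + X](_ : _ = \sum_(C : {set E} | (i \notin C) && (j \notin C))
    pos_sign i C * pos_sign j C * (u (j |: C) * v (i |: C))); last first.
  rewrite /ext_form [RHS]big_mkcond; apply: eq_bigr => C _.
  rewrite !ffunE; case: (i \in C); case: (j \in C) => /=;
    by rewrite ?mul0r ?mulr0 // mulrACA [pos_sign j C * _]mulrC.
rewrite (reindex_setU1 i (fun D => j \in D)).
(* If [i = j], all signs square to 1 and the two sums are the parts of [ext_form u v] over the sets
   avoiding and containing [i]. *)
have [<-{j}|nij] := eqVneq i j.
  rewrite /ext_form [RHS](bigID [pred D : {set E} | i \in D]) /= [LHS]addrC.
  congr (_ + _).
    rewrite -[RHS](eq_bigl _ _ (fun D => andbT (i \in D))).
    rewrite (reindex_setU1 i predT (fun D => u D * v D)).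
    apply: eq_big => [C|C /andP[iC _]]; first by rewrite andbT andbb.
    by rewrite pos_sign_sqr mul1r.
  apply: eq_big => [C|C /andP[iC _]]; first by rewrite setU11 andbT.
  by rewrite setU1K // pos_sign_sqr mul1r.
(* If [i] and [j] differ, deleting both from [D] matches the sums term by term; exactly one of
   [i < j] and [j < i] holds, so the signs are opposite. *)
rewrite (eq_bigl (fun C : {set E} => (j \in C) && (i \notin C))); last first.
  by move=> C; rewrite /= !inE eq_sym (negPf nij) andbC.
rewrite (reindex_setU1 j (fun D => i \notin D)).
rewrite (eq_bigl (fun C : {set E} => (i \notin C) && (j \notin C))); last first.
  by move=> C; rewrite /= !inE (negPf nij) andbC.
rewrite -big_split big1 //= => C /andP[iC jC].
rewrite setU1K ?inE ?negb_or ?nij // setUCA setU1K ?inE ?negb_or 1?eq_sym ?nij //.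
rewrite !pos_signU1 // -mulrDl; apply/eqP; rewrite mulf_eq0; apply/orP; left.
by case: (ltgtP i j) nij => // _ _; rewrite expr0 expr1 !mulN1r ?mul1r ?mulrN ?mulNr addrC subrr.
Qed.

End InteriorProduct.

(** * The relations (FS) and wedge for the operators *)

Section Relations.
Set Implicit Arguments.
Unset Strict Implicit.
Variables (d : Order.disp_t) (E : finOrderType d) (M : matroid E) (F : flat M).
Implicit Types (G K L X : flat M) (A B C : {set E}) (b c : Btilde F).

(** Pairing with the basis monomials recovers every coordinate. This lets identities between
    adjoints be checked under the form. *)
Lemma Bform_inj b b' : (forall c, Bform b c = Bform b' c) -> b = b'.
Proof.
move=> eB; apply/val_inj/ffunP=> G; apply/ffunP=> B.
have [bB|nB] := boolP (minor_basis F G B); last by rewrite !Btilde_coef0.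
by rewrite -!(Bform_mon _ bB) ![Bform (Bmon _ _ _) _]BformC eB.
Qed.

Lemma Bform0r b : Bform b 0 = 0.
Proof. by rewrite BformC Bform0l. Qed.

Lemma BformNl b c : Bform (- b) c = - Bform b c.
Proof. by rewrite -mulrN1z BformZl mulrN1. Qed.

Lemma Btilde_eq0 b : (forall G, b G = 0) -> b = 0.
Proof. by move=> b0; apply/val_inj/ffunP=> G; rewrite b0 ffunE. Qed.

Lemma phi_raiseE K L b G :
  phi_raise K L b G = if (K ⋖ L) && (G == L) then dsum K L * b K else 0.
Proof. by rewrite /= ffunE. Qed.

Lemma phi_projE K b G : phi_proj K b G = if G == K then b K else 0.
Proof. by rewrite /= ffunE. Qed.

Lemma phi_lowerD K L : {morph phi_lower (F := F) K L : b c / b + c}.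
Proof.
by move=> b b'; apply: Bform_inj => c; rewrite BformDl !phi_lower_adjoint BformDl.
Qed.

Lemma Bform_proj K b c : Bform (phi_proj K b) c = ext_form (b K) (c K).
Proof.
rewrite /Bform (bigD1 K) //= big1 => [|G nG].
  by rewrite addr0 ffunE eqxx.
rewrite ffunE (negPf nG).
exact: ext_form0l.
Qed.

Lemma Bform_raise K L b c : K ⋖ L ->
  Bform b (phi_raise K L c) = ext_form (b L) (dsum K L * c K).
Proof.
move=> cKL; rewrite /Bform (bigD1 L) //= big1 => [|G nG].
  by rewrite addr0 ffunE cKL eqxx.
rewrite ffunE (negPf nG) andbF.
exact: ext_form0r.
Qed.

Lemma phi_lower_out K L b G : G != K -> phi_lower K L b G = 0.
Proof.
move=> nG; apply/ffunP=> B; rewrite [RHS]ffunE.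
have [bB|nB] := boolP (minor_basis F G B); last by rewrite Btilde_coef0.
rewrite adjoint_coef // (_ : phi_raise _ _ _ = 0) ?Bform0r //.
apply: Btilde_eq0 => G'; rewrite phi_raiseE BmonE // ffunE [K == G]eq_sym (negPf nG).
by rewrite mulr0; case: ifP.
Qed.

(** Lowering is contraction by the elements of [L :\: K], read only at bases [C] over [K]:
    contraction may also produce monomials outside that span, which the adjoint drops. *)
Lemma phi_lowerE K L b C : K ⋖ L -> minor_basis F K C ->
  phi_lower K L b K C = \sum_(i in L :\: K) interior i (b L) C.
Proof.
move=> cKL bC; rewrite adjoint_coef // Bform_raise // BmonE // ffunE eqxx.
rewrite mulr_suml ext_form_sumr; apply: eq_bigr => i _.
by rewrite interior_mon.
Qed.

Lemma interior_neq0 K b i C :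
  interior i (b K) C != 0 -> (i \notin C) && minor_basis F K (i |: C).
Proof.
rewrite ffunE; case: ifP => iC; rewrite ?eqxx //=.
by apply: contraR => nB; rewrite Btilde_coef0 // mulr0.
Qed.

Lemma interior_out K b i : i \notin K -> interior i (b K) = 0.
Proof.
move=> iK; apply/ffunP=> C; rewrite [RHS]ffunE; apply/eqP/contraT.
case/interior_neq0/andP=> _ /and4P[_ /subsetP/(_ i)].
by rewrite setU11 inE (negPf iK) andbF => /(_ isT).
Qed.

(** A basis [A] determines its flat as the closure of [F :|: A], so distinct summands share no
    monomial. *)
Lemma ext_form_flats K K' b c : K != K' -> ext_form (b K) (c K') = 0.
Proof.
move=> nK; apply: big1 => A _.
have [bA|nA] := boolP (minor_basis F K A); last by rewrite Btilde_coef0 ?mul0r.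
rewrite [c _ _]Btilde_coef0 ?mulr0 //; apply: contraNN nK => bA'.
case/and4P: bA => _ _ _ /eqP eK; case/and4P: bA' => _ _ _ /eqP eK'.
by apply/eqP/val_inj; rewrite /= -eK -eK'.
Qed.

(** The set [F :|: C] lies in the meet and spans [K] once [i] is added, so its rank is at least that
    of [K] minus one. The meet is a proper subflat of [K], hence both have rank exactly one less
    than [K]. *)
Lemma minor_basis_meet K K' L i j C : K ⋖ L -> K' ⋖ L -> K != K' ->
  i \notin C -> j \notin C ->
  minor_basis F K (i |: C) -> minor_basis F K' (j |: C) ->
  (flat_meet K K' ⋖ K) && minor_basis F (flat_meet K K') C.
Proof.
move=> cK cK' nK iC jC /and4P[FK sK /eqP rK /eqP clK] /and4P[FK' sK' _ _].
set X := flat_meet K K'.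
have pXK : X \proper K := cocovers_meet_proper cK cK' nK.
have FX : F \subset X by rewrite subsetI FK.
have sC : C \subset X :\: F.
  have sCK := subset_trans (subsetUr _ _) sK.
  have sCK' := subset_trans (subsetUr _ _) sK'.
  by move: sCK sCK'; rewrite !subsetD subsetI => /andP[-> ->] /andP[->].
have sFC : F :|: C \subset X by rewrite subUset FX (subset_trans sC) ?subsetDl.
have leK : (rank M K <= (rank M (F :|: C)).+1)%N.
  by rewrite -clK rank_closure setUCA rankU1_le.
have ltX := flat_rank_lt pXK.
have leX : (rank M X <= rank M (F :|: C))%N by rewrite -ltnS (leq_trans ltX).
have eX : rank M (F :|: C) = rank M X by apply/eqP; rewrite eqn_leq leX rankS.
have rX : rank M K = (rank M X).+1.
  by apply/eqP; rewrite eqn_leq ltX andbT -eX.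
rewrite covers_of_rank //=; apply/and4P; split=> //.
  by rewrite -eqSS -rX -rK cardsU1 iC.
by rewrite (closure_eq_rank sFC).
Qed.

Lemma phi_raise_square L K b : L \proper K -> rank M K = (rank M L + 2)%N ->
  \sum_(X : flat M | (L ⋖ X) && (X ⋖ K)) phi_raise X K (phi_raise L X b) = 0.
Proof.
move=> pLK rK; apply: Btilde_eq0 => G; rewrite Btilde_sumE.
(* Replacing [dsum X K] by [dsum L K] makes the left factor independent of [X]; the added term
   [dsum L X] squares to zero. *)
transitivity (\sum_(X | (L ⋖ X) && (X ⋖ K))
    if G == K then dsum L K * dsum L X * b L else 0).
  apply: eq_bigr => X /andP[cX cK]; rewrite !phi_raiseE cX cK eqxx /=.
  case: ifP => // _; rewrite mulrA; congr (_ * _).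
  rewrite [dsum L K](_ : _ = dsum L X + dsum X K).
    by rewrite mulrDl sum_ext_gen_sqr add0r.
  have sLX := subsetP (proper_sub (covers_proper cX)).
  have sXK := subsetP (proper_sub (covers_proper cK)).
  rewrite [LHS](bigID (mem X)) /=.
  congr (_ + _); apply: eq_bigl => i; rewrite !inE.
    by have [/sXK->|] := boolP (i \in X); rewrite ?andbT ?andbF.
  by have [|/(contra (sLX i))->] := boolP (i \in X); rewrite ?andbT ?andbF.
case: (G == K); last by rewrite big1.
rewrite -mulr_suml -mulr_sumr.
rewrite (_ : \sum_(X | _) dsum L X = dsum L K) ?sum_ext_gen_sqr ?mul0r //.
rewrite /dsum (exchange_big_dep (mem (K :\: L))) /=; last first.
  move=> X i /andP[_ /covers_proper/proper_sub/subsetP sXK].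
  by rewrite !inE => /andP[-> /sXK].
(* Each [i] in [K :\: L] lies in exactly one intermediate flat, so it is counted once. *)
apply: eq_bigr => i iKL.
have [X0 eX0] := cover_between_unique (proper_sub pLK) rK iKL.
rewrite (big_pred1 X0) // => X; rewrite /= -eX0 -andbA.
by move: iKL; rewrite !inE => /andP[-> _].
Qed.

Lemma phi_lower_square L K b : L \proper K -> rank M K = (rank M L + 2)%N ->
  \sum_(X : flat M | (L ⋖ X) && (X ⋖ K)) phi_lower L X (phi_lower X K b) = 0.
Proof.
move=> pLK rK; apply: Bform_inj => c; rewrite Bform0l Bform_suml.
under eq_bigr do rewrite !phi_lower_adjoint.
by rewrite -Bform_sumr phi_raise_square // Bform0r.
Qed.

(** In the double sum over [i], [j] in [L :\: K], contracting [c K] by [i] gives zero because [i] is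
    outside [K]. Only the diagonal Kronecker terms survive, one for each [i]. *)
Lemma phi_lower_raise_id K L b :
  K ⋖ L -> phi_lower K L (phi_raise K L b) = phi_proj K b *+ #|L :\: K|.
Proof.
move=> cK; apply: Bform_inj => c.
rewrite phi_lower_adjoint Bform_raise // phi_raiseE cK eqxx /=.
rewrite pmulrn BformZl Bform_proj.
rewrite /dsum !mulr_suml ext_form_suml.
rewrite (eq_bigr (fun=> ext_form (b K) (c K))) => [|i iLK].
  by rewrite sumr_const -mulr_natr natz /ext_form mulr_suml.
rewrite ext_form_sumr (bigD1 i) //= big1 => [|j /andP[jLK nij]].
  rewrite addr0 ext_form_gen_gen eqxx (interior_out c) ?ext_form0r ?subr0 //.
  by move: iLK; rewrite inE => /andP[].
rewrite ext_form_gen_gen eq_sym (negPf nij) (interior_out c) ?ext_form0r ?subr0 //.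
by move: iLK; rewrite inE => /andP[].
Qed.

Lemma phi_lower_raise_meet K K' L b : K ⋖ L -> K' ⋖ L -> K != K' ->
  phi_lower K L (phi_raise K' L b) =
    if flat_meet K K' ⋖ K then
      - phi_raise (flat_meet K K') K (phi_lower (flat_meet K K') K' b)
    else 0.
Proof.
move=> cK cK' nK; apply: Bform_inj => c; set X := flat_meet K K'.
rewrite phi_lower_adjoint Bform_raise // phi_raiseE cK' eqxx /=.
(* Contracting [u K2] by an element outside [K2] gives zero, which cuts the index set down to [K2]
   minus the meet. *)
have dsumE (K1 K2 : flat M) (u : Btilde F) C : K2 ⋖ L -> K1 :&: K2 = K :&: K' ->
    \sum_(i in L :\: K1) interior i (u K2) C =
    \sum_(i in K2 :\: (K :&: K')) interior i (u K2) C.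
  move=> cK2 <-; rewrite [LHS](bigID (mem K2)) /= addrC big1 ?add0r.
    apply: eq_bigl => i; rewrite !inE.
    have [iK2|] := boolP (i \in K2); last by rewrite !andbF.
    by rewrite (subsetP (proper_sub (covers_proper cK2))) ?andbT.
  by move=> i /andP[_ iK2]; rewrite interior_out // ffunE.
(* The Kronecker terms vanish since [K] and [K'] are distinct; for each [C] the remaining double sum
   factors. *)
transitivity (- \sum_C (\sum_(i in K' :\: X) interior i (b K') C) *
                       (\sum_(i in K :\: X) interior i (c K) C)).
  rewrite !mulr_suml ext_form_suml -sumrN.
  rewrite (eq_bigr (fun i => \sum_(j in L :\: K) \sum_C
     - (interior j (b K') C * interior i (c K) C))); last first.
    move=> i _; rewrite ext_form_sumr; apply: eq_bigr => j _.
    rewrite ext_form_gen_gen ext_form_flats 1?eq_sym // if_same sub0r.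
    by rewrite /ext_form sumrN.
  under eq_bigr do rewrite exchange_big.
  rewrite exchange_big; apply: eq_bigr => C _ /=.
  rewrite -(dsumE K K') // -(dsumE K' K) 1?setIC // mulr_suml -sumrN exchange_big /=.
  apply: eq_bigr => j _; rewrite mulr_sumr -sumrN.
  by apply: eq_bigr.
have offX C : ~~ ((X ⋖ K) && minor_basis F X C) ->
    (\sum_(i in K' :\: X) interior i (b K') C) *
    (\sum_(i in K :\: X) interior i (c K) C) = 0.
  apply: contraNeq; rewrite mulf_eq0 negb_or => /andP[].
  move=> /sum_neq0_ex[j _ /interior_neq0/andP[jC bj]].
  move=> /sum_neq0_ex[i _ /interior_neq0/andP[iC bi]].
  exact: (minor_basis_meet cK cK' nK iC jC).
case: ifP offX => [cX|_] offX; last first.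
  by rewrite Bform0l big1 ?oppr0 // => C _; apply: offX.
have cX' := cocovers_meetr cK cK' nK cX.
(* Moving the raising operator across the form leaves a pairing of two lowered elements, both
   concentrated at [X], where [phi_lowerE] gives the two factors. *)
rewrite BformNl BformC -phi_lower_adjoint BformC; congr (- _).
rewrite /Bform (bigD1 X) //= [X in _ = _ + X]big1 ?addr0 => [|G nG].
  apply: eq_bigr => C _.
  have [bC|nC] := boolP (minor_basis F X C); last first.
    by rewrite !(Btilde_coef0 _ nC) mul0r offX // cX.
  by rewrite !phi_lowerE.
by rewrite phi_lower_out // ext_form0l.
Qed.

End Relations.

(** * The action of the path algebra and its descent to the quotient *)

Section FlagAction.
Set Implicit Arguments.
Unset Strict Implicit.
Variables (d : Order.disp_t) (E : finOrderType d) (M : matroid E) (F : flat M).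
Implicit Types (G K L X : flat M) (b c : Btilde F) (s t : seq (flat M)).
Implicit Types (x y : path_alg M) (p q : flag_path M).

Lemma additive0 (U V : zmodType) (f : U -> V) :
  {morph f : u v / u + v} -> f 0 = 0.
Proof. by move=> fD; apply: (addrI (f 0)); rewrite -fD !addr0. Qed.

Lemma phi_proj_id K b : (forall G, G != K -> b G = 0) -> phi_proj K b = b.
Proof.
move=> b0; apply/val_inj/ffunP=> G; rewrite [LHS]phi_projE.
by case: eqVneq => [->//|/b0->].
Qed.

Lemma phi_projD K : {morph phi_proj (F := F) K : b c / b + c}.
Proof.
move=> b c; apply/val_inj/ffunP=> G; rewrite /= !ffunE.
by case: ifP; rewrite ?addr0.
Qed.

Lemma phi_stepD K L : {morph phi_step (F := F) K L : b c / b + c}.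
Proof.
move=> b c; rewrite /phi_step.
by case: ifP => _; [apply: phi_lowerD | apply: phi_raiseD].
Qed.

Lemma phi_step_out K L b G : G != K -> phi_step K L b G = 0.
Proof.
move=> nG; rewrite /phi_step; case: ifP => _; first exact: phi_lower_out.
by rewrite phi_raiseE (negPf nG) andbF.
Qed.

Lemma phi_step_proj K L b : phi_step K L (phi_proj L b) = phi_step K L b.
Proof.
rewrite /phi_step; case: ifP => [cKL|_].
  apply: Bform_inj => c; rewrite !phi_lower_adjoint !Bform_raise //.
  by rewrite phi_projE eqxx.
by apply/val_inj/ffunP=> G; rewrite [LHS]phi_raiseE [RHS]phi_raiseE phi_projE eqxx.
Qed.

(** [phi_path] ends a path with a bare step and no projection. A step reads only the component at
    [L], so inserting [phi_proj L] changes nothing and the recursion becomes uniform. *)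
Lemma phi_path_cons K L s b :
  phi_path K (L :: s) b = phi_step K L (phi_path L s b).
Proof. by case: s => //=; rewrite phi_step_proj. Qed.

Lemma phi_path_out K s b G : G != K -> phi_path K s b G = 0.
Proof.
case: s => [|L s] nG; last by rewrite phi_path_cons phi_step_out.
by rewrite phi_projE (negPf nG).
Qed.

Lemma phi_pathD K s : {morph phi_path (F := F) K s : b c / b + c}.
Proof.
elim: s K => [|L s IHs] K b c; first exact: phi_projD.
by rewrite !phi_path_cons IHs phi_stepD.
Qed.

Lemma phi_path_cat K s t b :
  phi_path K (s ++ t) b = phi_path K s (phi_path (last K s) t b).
Proof.
elim: s K => [|L s IHs] K; last by rewrite cat_cons !phi_path_cons IHs.
by rewrite /= phi_proj_id // => G; apply: phi_path_out.
Qed.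

(** The inner result is concentrated at [K'], and the projection onto [last K s] kills it. This
    matches the zero product of non-composable paths. *)
Lemma phi_path_mismatch K s K' t b :
  last K s != K' -> phi_path K s (phi_path K' t b) = 0.
Proof.
move=> nK; rewrite -{1}[s]cats0 phi_path_cat /= (_ : phi_proj _ _ = 0).
  exact: additive0 (@phi_pathD K s).
apply: Btilde_eq0 => G; rewrite phi_projE.
by case: ifP => // _; apply: phi_path_out.
Qed.

Definition path_act x b : Btilde F := mlin (fun p => phi_path p.1 p.2 b) x.

Lemma path_act_gen p b : path_act (flag_gen p) b = phi_path p.1 p.2 b.
Proof. by rewrite flag_genE /path_act mlinU. Qed.

Lemma path_actDl b : {morph path_act^~ b : x y / x + y}.
Proof. by move=> x y; rewrite /path_act mlinD. Qed.

Lemma path_act0l b : path_act 0 b = 0.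
Proof. exact: additive0 (@path_actDl b). Qed.

Lemma path_actNl x b : path_act (- x) b = - path_act x b.
Proof. by apply/eqP; rewrite -addr_eq0 -path_actDl addNr path_act0l. Qed.

Lemma path_act_suml (I : Type) (r : seq I) (P : pred I) (f : I -> path_alg M) b :
  path_act (\sum_(i <- r | P i) f i) b = \sum_(i <- r | P i) path_act (f i) b.
Proof. exact: (big_morph (path_act^~ b) (path_actDl b) (path_act0l b)). Qed.

Lemma path_actDr x : {morph path_act x : b c / b + c}.
Proof.
move=> b c; rewrite /path_act -mlin_funD; apply: eq_mlin => p.
exact: phi_pathD.
Qed.

Lemma path_act0r x : path_act x 0 = 0.
Proof. exact: additive0 (@path_actDr x). Qed.

Lemma path_actNr x b : path_act x (- b) = - path_act x b.
Proof. by apply/eqP; rewrite -addr_eq0 -path_actDr addNr path_act0r. Qed.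

Lemma path_act_flag K s b :
  path (fun K L => (K ⋖ L) || (L ⋖ K)) K s ->
  path_act (flag K s) b = phi_path K s b.
Proof.
move=> pKs; pose p : flag_path M := @FlagPath _ M (K, s) pKs.
by rewrite -[flag K s]/(flag p.1 p.2) flagEgen path_act_gen.
Qed.

Lemma path_actM x y b : path_act (x * y) b = path_act x (path_act y b).
Proof.
rewrite -[x * y]/(path_mul x y).
elim/path_alg_ind: x => [|x x' Hx Hx'|x Hx|p].
- by rewrite path_mul0l !path_act0l.
- by rewrite path_mulDl !path_actDl Hx Hx'.
- by rewrite path_mulNl !path_actNl Hx.
elim/path_alg_ind: y => [|y y' Hy Hy'|y Hy|q].
- by rewrite path_mul0r path_act0l path_act0r.
- by rewrite path_mulDr !path_actDl path_actDr Hy Hy'.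
- by rewrite path_mulNr !path_actNl path_actNr Hy.
rewrite path_mul_gen !path_act_gen.
have [e|n] := boolP (last p.1 p.2 == q.1).
  have [r [r1 r2] ->] := concat_some e.
  by rewrite path_act_gen r1 r2 phi_path_cat (eqP e).
by rewrite /concat (negPf n) path_act0l phi_path_mismatch.
Qed.

(** The unit is the sum of the one-flat paths, which act as the projections onto the summands. *)
Lemma path_act1 b : path_act 1 b = b.
Proof.
rewrite -[1]/(path_one M) /path_one path_act_suml.
apply/val_inj/ffunP=> G; rewrite [LHS]Btilde_sumE (bigD1 G) //=.
rewrite path_act_flag // [LHS](_ : _ = phi_proj G b G + 0).
  by rewrite phi_projE eqxx addr0.
congr (_ + _); apply: big1 => K nK.
by rewrite path_act_flag // phi_path_out // eq_sym.
Qed.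

(** The last step of a path acts first, so ascending flags act by lowerings and descending ones by
    raisings; [covers_asym] selects the branch of [phi_step]. *)
Lemma path_act_relation x b : S_relation x -> path_act x b = 0.
Proof.
case=> {x} [L K pLK rK|L K pLK rK|K K' L cK cK'].
- rewrite path_act_suml -[RHS](phi_lower_square b pLK rK).
  apply: eq_bigr => X /andP[cX cXK].
  by rewrite path_act_flag /= ?cX ?cXK // /phi_step cX cXK.
- rewrite path_act_suml -[RHS](phi_raise_square b pLK rK).
  apply: eq_bigr => X /andP[cX cXK].
  rewrite path_act_flag /= ?cX ?cXK ?orbT //.
  by rewrite /phi_step (negPf (covers_asym cX)) (negPf (covers_asym cXK)).
rewrite path_actDl path_actNl path_act_flag /= ?cK ?cK' ?orbT //.
rewrite /phi_step cK (negPf (covers_asym cK')).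
apply/eqP; rewrite subr_eq0; apply/eqP.
have [<-{K' cK'}|nK] := eqVneq K K'.
  rewrite phi_lower_raise_id //; elim: #|_| => [|n IHn].
    by rewrite !mulr0n path_act0l.
  by rewrite !mulrS path_actDl -IHn path_act_flag.
rewrite phi_lower_raise_meet //; case: ifP => cX; last by rewrite path_act0l.
have cX' := cocovers_meetr cK cK' nK cX.
rewrite path_actNl path_act_flag /= ?cX ?cX' ?orbT //.
by rewrite /phi_step (negPf (covers_asym cX)) cX'.
Qed.

Lemma path_act_ideal x b : ideal_gen (@S_relation E M) x -> path_act x b = 0.
Proof.
(* The vector [b] stays general: for [x * a] the induction hypothesis is applied to
   [path_act a b]. *)
move=> Ix; elim: Ix b => {x} [x Sx|| x y _ Hx _ Hy|a x _ Hx|a x _ Hx] b.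
- exact: path_act_relation.
- exact: path_act0l.
- by rewrite path_actDl path_actNl Hx Hy subr0.
- by rewrite path_actM Hx path_act0r.
- by rewrite path_actM Hx.
Qed.

(** The chosen representative is immaterial, because the ideal acts by zero; [flag_act_class]
    records this. *)
Definition flag_act (u : flag_alg M) b : Btilde F := path_act (repr u) b.

Lemma flag_act_class x b :
  flag_act (quot_class (@S_relation E M) x) b = path_act x b.
Proof.
apply/eqP; rewrite -subr_eq0 -path_actNl -path_actDl; apply/eqP.
by apply: path_act_ideal; apply/quot_classP; rewrite quot_classK.
Qed.

Lemma flag_act_law : left_module_law flag_act.
Proof.
split=> [u v b|b|u b c|b u v].
- rewrite -[u]quot_classK -[v]quot_classK -[_ * _]quot_classM.
  by rewrite !flag_act_class path_actM.
- by rewrite -[1]/(quot_class (@S_relation E M) 1) flag_act_class path_act1.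
- exact: path_actDr.
- rewrite -[u]quot_classK -[v]quot_classK -quot_classD !flag_act_class.
  exact: path_actDl.
Qed.

End FlagAction.

Theorem proposition10p1 (d : Order.disp_t) (E : finOrderType d) (M : matroid E)
    (F : flat M) :
  [/\ (* (FS), ascending flags *)
      forall L K : flat M, L \proper K -> rank M K = (rank M L + 2)%N ->
      forall b : Btilde F,
        \sum_(X : flat M | (L ⋖ X) && (X ⋖ K))
          phi_lower L X (phi_lower X K b) = 0,
      (* (FS), descending flags *)
      forall L K : flat M, L \proper K -> rank M K = (rank M L + 2)%N ->
      forall b : Btilde F,
        \sum_(X : flat M | (L ⋖ X) && (X ⋖ K))
          phi_raise X K (phi_raise L X b) = 0,
      (* the wedge relation *)
      forall K K' L : flat M, K ⋖ L -> K' ⋖ L ->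
      forall b : Btilde F,
        phi_lower K L (phi_raise K' L b) =
          (if K == K' then phi_proj K b *+ #|L :\: K|
           else if flat_meet K K' ⋖ K then
             - phi_raise (flat_meet K K') K (phi_lower (flat_meet K K') K' b)
           else 0)
    & (* the induced S(M)-module structure *)
      exists2 act : flag_alg M -> Btilde F -> Btilde F,
        left_module_law act &
        forall (p : flag_path M) (b : Btilde F),
          act (flag_class p) b = phi_path p.1 p.2 b].
Proof.
split=> [L K pLK rK b|L K pLK rK b|K K' L cK cK' b|].
- exact: phi_lower_square.
- exact: phi_raise_square.
- have [<-|nK] := eqVneq K K'; first exact: phi_lower_raise_id.
  exact: phi_lower_raise_meet.
exists (@flag_act d E M F); first exact: flag_act_law.
by move=> p b; rewrite flag_act_class -flag_genE path_act_gen.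
Qed.
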